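(* Let $\alpha\in(0,2]$, $\lambda>0$, $v_0\in\mathbb{C}\setminus\{0\}$, and let $V$ be the complex-valued Ornstein-Uhlenbeck process $$V_t=v_0+J_t-\lambda\int_0^t V_s\,ds,$$ where $(J_t)_{t\ge0}$ is an isotropic $\alpha$-stable process in the complex plane started from $0$. Let $$\widehat{\alpha}(t)=\int_0^t e^{\alpha\lambda s}\,ds=\frac{e^{\alpha\lambda t}-1}{\alpha\lambda},\qquad \widehat{\alpha}^{-1}(t)=\frac{1}{\alpha\lambda}\log(1+\alpha\lambda t),$$ and let $\widetilde{J}$ be the $\alpha$-stable process started from $v_0$ such that $v_0+\int_0^t e^{\lambda s}\,dJ_s=\widetilde{J}_{\widehat{\alpha}(t)}$ for all $t\ge0$. Then $$\theta^{V}_{t}=\theta^{\widetilde{J}}_{\widehat{\alpha}(t)},\qquad t\ge 0.$$ Hence, for $c>0$, the hitting times $\tau^{|\theta^{V}|}_{c}=\inf\{t\ge0:|\theta^{V}_{t}|=c\}$ and $\tau^{|\theta^{\widetilde{J}}|}_{c}=\inf\{t\ge0:|\theta^{\widetilde{J}}_{t}|=c\}$ satisfy $$\tau^{|\theta^{V}|}_{c}=\frac{1}{\alpha\lambda}\log\left(1+\alpha\lambda\,\tau^{|\theta^{\widetilde{J}}|}_{c}\right),$$ or equivalently, for $u>0$, $$\mathbb{E}\left[e^{-u\tau^{|\theta^{V}|}_{c}}\right]=\mathbb{E}\left[\left(1+\alpha\lambda\,\tau^{|\theta^{\widetilde{J}}|}_{c}\right)^{-u/(\alpha\lambda)}\r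ight].$$
   Context: For $\alpha=2$ the stable process is planar Brownian motion. Winding process: for a càdlàg process $X$ in $\mathbb{C}$ started from a nonzero point which a.s. does not hit $0$ and a.s. has no jump across $0$ (as is the case for $V$ and $\widetilde{J}$), one fills in the jumps of the path of $X$ on $[0,t]$ by line segments to obtain a continuous curve avoiding $0$; $\theta^X_t$ is the total variation of the continuous argument along this curve from its start to its end (so $\theta^X_0=0$; ''variation'' means net increment). *)

(* Defs.v *)
From HB Require Import structures.
From mathcomp Require Import all_boot all_order all_algebra complex.
From mathcomp Require Import all_classical all_reals all_analysis.

Set Implicit Arguments.
Unset Strict Implicit.
Unset Printing Implicit Defensive.

Import Order.TTheory GRing.Theory Num.Theory.
Import numFieldTopology.Exports numFieldNormedType.Exports.

Local Open Scope classical_set_scope.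
Local Open Scope ring_scope.
Local Open Scope complex_scope.

(* The alias [R[i]^o] carries the topology of the modulus; [R[i]] has none. *)
Notation Cplx R := ((R[i] : numFieldType)^o).

Section complex_plane.
Context {R : realType}.
Implicit Types (z : Cplx R) (x : R -> Cplx R).

Definition plane z : R * R := (complex.Re z, complex.Im z).

Definition modulus z : R := Num.sqrt (complex.Re z ^+ 2 + complex.Im z ^+ 2).

Definition inner z1 z2 : R :=
  complex.Re z1 * complex.Re z2 + complex.Im z1 * complex.Im z2.

Definition expi (phi : R) : Cplx R := cos phi +i* sin phi.

Definition Cintegral x (a b : R) : Cplx R :=
  (\int[lebesgue_measure]_(s in `[a, b]) complex.Re (x s)) +i*
  (\int[lebesgue_measure]_(s in `[a, b]) complex.Im (x s)).

(* Only the restriction of a path to [0, +oo[ is meaningful. *)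
Definition cadlag x : Prop := forall t : R, 0 <= t ->
  x s @[s --> t^'+] --> x t /\ (0 < t -> cvg (x s @[s --> t^'-])).

(* x(t-), with the convention x(0-) = x(0). *)
Definition left_limit x (t : R) : Cplx R :=
  if t <= 0 then x 0 else lim (x s @[s --> t^'-]).

End complex_plane.

Section winding.
Context {R : realType}.
Implicit Types (x gamma : R -> Cplx R) (t : R).

(* [gamma] on [0, 1] runs through the path [x] on [0, t], each jump being
   filled in by the line segment from x(s-) to x(s): [r p] is the time reached
   at parameter [p], and [q p] is the position on the segment attached to that
   time, along which [gamma] never moves backwards. *)
Definition fills_jumps x t gamma : Prop :=
  exists r q : R -> R,
    [/\ {within `[0, 1], continuous r}, r 0 = 0 & r 1 = t] /\
    [/\ {in `[0, 1] &, {homo r : p p' / p <= p'}},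
        {in `[0, 1], forall p, 0 <= q p <= 1} &
        {in `[0, 1] &, forall p p', p <= p' -> r p = r p' -> q p <= q p'}] /\
    [/\ {within `[0, 1], continuous gamma},
        {in `[0, 1], forall p, gamma p =
           (1 - q p)%:C * left_limit x (r p) + (q p)%:C * x (r p)} &
        gamma 1 = x t].

Definition continuous_argument gamma (phi : R -> R) : Prop :=
  {within `[0, 1], continuous phi} /\
  {in `[0, 1], forall p, gamma p = `|gamma p| * expi (phi p)}.

Definition is_winding x t (v : R) : Prop :=
  exists gamma (phi : R -> R),
    [/\ fills_jumps x t gamma,
        {in `[0, 1], forall p, gamma p != 0},
        continuous_argument gamma phi &
        v = phi 1 - phi 0].

(* The net variation of the continuous argument. All the filled-in curves of
   [x] on [0, t] are reparametrisations of each other, so there is at most one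
   [v] with [is_winding x t v]; the default 0 is only used for paths that are
   not cadlag, hit 0, have a zero left limit or jump across 0. *)
Definition winding x t : R := xget 0 [set v | is_winding x t v].

(* inf {t >= 0 : |theta t| = c}, equal to +oo if the level is never attained. *)
Definition abs_hitting_time (theta : R -> R) (c : R) : \bar R :=
  ereal_inf [set t%:E | t in [set t : R | 0 <= t /\ `|theta t| = c]].

End winding.

Section processes.
Context {d : measure_display} {T : measurableType d} {R : realType}.
Variable P : probability T R.
Implicit Types (X J V I : R -> T -> Cplx R).

Definition complex_process X : Prop :=
  forall t, 0 <= t -> measurable_fun setT (fun w => plane (X t w)).

(* Subfamilies are covered, since some of the [B i] may be the whole plane. *)
Definition mutually_independent n (Y : 'I_n -> T -> R * R) : Prop :=
  forall B : 'I_n -> set (R * R), (forall i, measurable (B i)) ->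
    P (\bigcap_(i in [set: 'I_n]) (Y i @^-1` B i)) =
    (\prod_(i < n) P (Y i @^-1` B i))%E.

Definition independent_increments X : Prop :=
  forall (n : nat) (t : nat -> R), 0 <= t 0%N -> (forall i, t i <= t i.+1) ->
    mutually_independent (fun (i : 'I_n) w => plane (X (t i.+1) w - X (t i) w)).

Definition stationary_increments X : Prop :=
  forall (s h : R) (B : set (R * R)), 0 <= s -> 0 <= h -> measurable B ->
    P [set w | B (plane (X (s + h) w - X s w))] =
    P [set w | B (plane (X h w - X 0 w))].

(* Isotropic alpha-stable (Levy) process started from z0: the characteristic
   function E exp(i <xi, X_t - X_0>) is exp(- kappa t |xi|^alpha); it is
   written through its real and imaginary parts. The scale kappa > 0 is left
   free, so that alpha = 2 includes both usual normalisations of planar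
   Brownian motion. *)
Record isotropic_stable (alpha : R) (z0 : Cplx R) X : Prop := {
  stable_process : complex_process X;
  stable_cadlag : {ae P, forall w, cadlag (X^~ w)};
  stable_start : {ae P, forall w, X 0 w = z0};
  stable_indep : independent_increments X;
  stable_stationary : stationary_increments X;
  stable_charfun : exists2 kappa : R, 0 < kappa &
    forall (t : R) (xi : Cplx R), 0 <= t ->
      ('E_P[fun w => cos (inner xi (X t w - X 0 w))%R] =
        (expR (- (kappa * t * modulus xi `^ alpha)))%:E)%E /\
      ('E_P[fun w => sin (inner xi (X t w - X 0 w))%R] = 0)%E }.

Record ornstein_uhlenbeck (lambda : R) (v0 : Cplx R) J V : Prop := {
  ou_process : complex_process V;
  ou_cadlag : {ae P, forall w, cadlag (V^~ w)};
  ou_eq : {ae P, forall w, forall t : R, 0 <= t ->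
    V t w = v0 + J t w - lambda%:C * Cintegral (V^~ w) 0 t} }.

Definition mesh (a b : R) (s : seq R) : R :=
  \big[Order.max/0]_(0 <= k < size s) (nth b s k - nth b (a :: s) k).

Definition riemann_sum (f : R -> R) J (a b : R) (s : seq R) (w : T) : Cplx R :=
  \sum_(0 <= k < size s)
    (f (nth b (a :: s) k))%:C * (J (nth b s k) w - J (nth b (a :: s) k) w).

(* I_t = int_0^t f(s) dJ_s for a continuous deterministic integrand f and a
   semimartingale integrator J: the limit in probability of the left-endpoint
   Riemann sums along partitions of [0, t] with vanishing mesh. *)
Definition is_stochastic_integral (f : R -> R) J I : Prop :=
  complex_process I /\
  forall (t : R) (s : nat -> seq R), 0 <= t ->
    (forall n, itv_partition 0 t (s n)) ->
    mesh 0 t (s n) @[n --> \oo] --> (0 : R) ->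
    forall eps : R, 0 < eps ->
      P [set w | eps < modulus (riemann_sum f J 0 t (s n) w - I t w)]
        @[n --> \oo] --> 0%E.

End processes.

Section time_change.
Context {R : realType}.

Definition alpha_hat (alpha lambda t : R) : R :=
  \int[lebesgue_measure]_(s in `[0, t]) expR (alpha * lambda * s).

Definition alpha_hat_inv (alpha lambda t : R) : R :=
  (alpha * lambda)^-1 * ln (1 + alpha * lambda * t).

End time_change.

(* Main.v *)
Require Import Defs.
From HB Require Import structures.
From mathcomp Require Import all_boot all_order all_algebra complex.
From mathcomp Require Import all_classical all_reals all_analysis.
From mathcomp Require Import measurable_realfun ring lra.

Set Implicit Arguments.
Unset Strict Implicit.
Unset Printing Implicit Defensive.

Import Order.TTheory GRing.Theory Num.Theory.
Import numFieldTopology.Exports numFieldNormedType.Exports.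

Local Open Scope classical_set_scope.
Local Open Scope ring_scope.
Local Open Scope complex_scope.

(** Everything rests on one pathwise identity: almost surely, for all [t >= 0],
    [exp (lambda t) * V t = Jt (alpha_hat t)].
    Multiplying a path by a positive continuous real factor does not change its
    argument, and an increasing change of time only reparametrises the curve
    obtained by filling in the jumps, so the identity turns every winding
    number of [V] on [0, t] into a winding number of [Jt] on [0, alpha_hat t]
    and conversely ([is_winding_time_change]). The two sets of winding numbers
    coincide, hence so do the values [winding] selects from them.

    The identity is an integration by parts, done on Riemann sums. Write [J] as [V - v0 + lambda * int V] in the left-endpoint
    Riemann sums of [exp (lambda s)] against [J]. They telescope to
    [exp (lambda t) * V t - v0] plus [lambda] times the integral of
    [exp (lambda l(s)) * V s - exp (lambda s) * V (r(s))], where [l(s)] and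
    [r(s)] are the grid points around [s]. As [V] is right-continuous and
    locally bounded, this integral vanishes in the limit by dominated
    convergence ([cvg_riemann_grid]). So the Riemann sums converge almost surely
    to [exp (lambda t) * V t - v0], and in probability to [I t]; these limits
    agree almost surely ([ae_le0_of_cvg_in_probability], [ou_exp_integral]).
    This gives the identity for each fixed [t > 0], thus for all positive
    rational [t] at once, thus for all [t >= 0] by right continuity
    ([time_changed_path_eq]).

    For the hitting times, an increasing bijection of the half-line commutes
    with infima, an empty set of hitting times being sent to [+oo]
    ([abs_hitting_time_time_change]). The Laplace transforms are integrals of
    functions of [w] whose measurability is unclear; they agree because the integral of a nonnegative function is a supremum
    over simple functions, which null sets do not influence
    ([ae_eq_ge0_integral]). *)

(** * Integrals of exponentials *)

Section exp_integral.
Context {R : realType}.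
Notation mu := (@lebesgue_measure R).

Lemma integrable_expR_scaled (c a b : R) :
  mu.-integrable `[a, b] (EFin \o (fun s => expR (c * s))).
Proof.
apply: continuous_compact_integrable; first exact: segment_compact.
apply: continuous_subspaceT => x.
apply: (@continuous_comp _ _ _ (fun s => c * s) expR); last exact: continuous_expR.
exact: mulrl_continuous.
Qed.

Lemma is_derive_expR_scaled (c x : R) :
  is_derive x 1 (fun s => expR (c * s)) (c * expR (c * x)).
Proof.
rewrite mulrC; apply: (@is_derive1_comp _ expR (fun s => c * s) x (expR (c * x)) c).
have : is_derive x 1 (fun s : R => c *: s) (c *: (1:R)) by apply: is_deriveZ.
by rewrite /GRing.scale /= mulr1.
Qed.

Lemma Rintegral_expR_scaled (c a b : R) : a <= b ->
  \int[mu]_(s in `[a, b]) (c * expR (c * s)) = expR (c * b) - expR (c * a).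
Proof.
rewrite le_eqVlt => /predU1P[->|ab].
  by rewrite set_itv1 Rintegral_set1 subrr.
rewrite /Rintegral (@continuous_FTC2 _ _ (fun s => expR (c * s)))//.
- apply: continuous_subspaceT => x; apply: cvgM; first exact: cvg_cst.
  apply: (@continuous_comp _ _ _ (fun s => c * s) expR); last exact: continuous_expR.
  exact: mulrl_continuous.
- have dE x : derivable (fun s => expR (c * s)) x 1.
    exact: (@ex_derive _ _ _ _ _ _ _ (is_derive_expR_scaled c x)).
  have cE x : {for x, continuous (fun s => expR (c * s))}.
    exact/differentiable_continuous/derivable1_diffP.
  by split; [move=> x _; exact: dE|exact/cvg_at_right_filter/cE|exact/cvg_at_left_filter/cE].
- by move=> x _; rewrite derive1E (@derive_val _ _ _ _ _ _ _ (is_derive_expR_scaled c x)).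
Qed.

Lemma alpha_hatE (alpha lambda t : R) : 0 < alpha -> 0 < lambda -> 0 <= t ->
  alpha_hat alpha lambda t = (expR (alpha * lambda * t) - 1) / (alpha * lambda).
Proof.
move=> a0 l0 t0; have al0 : alpha * lambda != 0 by rewrite gt_eqF// mulr_gt0.
apply: (mulfI al0); rewrite [RHS]mulrCA divff// mulr1.
rewrite /alpha_hat -RintegralZl//=; last exact: integrable_expR_scaled.
by rewrite Rintegral_expR_scaled// mulr0 expR0.
Qed.

End exp_integral.

(** * Real cadlag functions and their discretisation *)

Section regulated.
Context {R : realType}.
Notation mu := (@lebesgue_measure R).

Definition real_cadlag (f : R -> R) : Prop := forall t, 0 <= t ->
  f s @[s --> t^'+] --> f t /\ (0 < t -> cvg (f s @[s --> t^'-])).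

(** Existence of one-sided limits bounds [f] near each point of the compact
    segment; at [0] only the right-hand side is controlled, which is why the
    covered property is restricted to nonnegative times. *)
Lemma real_cadlag_bounded (f : R -> R) (t : R) : real_cadlag f ->
  exists M, 0 <= M /\ forall s, 0 <= s <= t -> `|f s| <= M.
Proof.
move=> cf; have /compact_near_coveringP near_cover := @segment_compact _ 0 t.
have : \forall M \near +oo, `[0, t] `<=` [set s | 0 <= s -> `|f s| <= M].
  apply: (near_cover R (+oo : set_system R) (fun M s => 0 <= s -> `|f s| <= M)).
  move=> x; rewrite /= in_itv /= => /andP[x0 _].
  have [rc ll] := cf _ x0.
  have [Mr Hr] : exists Mr, \forall y \near x^'+, `|f y| <= Mr.
    exists (`|f x| + 1); near=> y.
    have : `|f x - f y| < 1 by near: y; exact: (cvgr_dist_lt _ _ rc).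
    move=> h; rewrite -[f y](subrK (f x)) addrC (le_trans (ler_normD _ _))//.
    by rewrite lerD2l distrC ltW.
  have [Ml Hl] : exists Ml, \forall y \near x^'-, 0 <= y -> `|f y| <= Ml.
    move: x0; rewrite le_eqVlt => /predU1P[x0|x0].
      exists 0; near=> y; rewrite leNgt => /negP; case.
      by rewrite x0; near: y; exact: nbhs_left_lt.
    have /cvg_ex[l lf] := ll x0; exists (`|l| + 1); near=> y => _.
    have : `|l - f y| < 1 by near: y; exact: (cvgr_dist_lt _ _ lf).
    move=> h; rewrite -[f y](subrK l) addrC (le_trans (ler_normD _ _))//.
    by rewrite lerD2l distrC ltW.
  have Hx : \forall y \near x, 0 <= y -> `|f y| <= Num.max `|f x| (Num.max Mr Ml).
    have [e /= e0 He] : nbhs x^'+ (fun y => `|f y| <= Mr) by [].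
    have [e' /= e'0 He'] : nbhs x^'- (fun y => 0 <= y -> `|f y| <= Ml) by [].
    near=> y => y0; rewrite !le_max.
    have xy_e : ball x e y by near: y; exact: nbhsx_ballx.
    have xy_e' : ball x e' y by near: y; exact: nbhsx_ballx.
    have [yx|xy|->] := ltgtP y x; last by rewrite lexx.
    - by rewrite (He' y)// !orbT.
    - by rewrite (He y)// orbT.
  exists ([set y | 0 <= y -> `|f y| <= Num.max `|f x| (Num.max Mr Ml)],
          [set M | Num.max `|f x| (Num.max Mr Ml) <= M]) => /=.
    by split => //; apply: nbhs_pinfty_ge; exact: num_real.
  by move=> [y M] /= [h1 h2] y0; exact: le_trans (h1 y0) h2.
move=> [M0 [_ HM]].
exists (`|M0| + 1); split; first by rewrite addr_ge0.
move=> s st; apply: (HM (`|M0| + 1) _ s).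
- by rewrite (le_lt_trans (ler_norm _))// ltrDl.
- by rewrite /= in_itv.
- by case/andP: st.
Unshelve. all: end_near. Qed.

(** On the grid of step [h], [grid_right h s] is strictly after [s] even when [s]
    is a grid point, so that right continuity of a path applies along it. *)
Definition grid_left (h s : R) : R := (Num.truncn (s / h))%:R * h.
Definition grid_right (h s : R) : R := (Num.truncn (s / h)).+1%:R * h.

Lemma grid_itv (h s : R) : 0 < h -> 0 <= s -> grid_left h s <= s < grid_right h s.
Proof.
move=> h0 s0; have /truncn_itv/andP[h1 h2] : 0 <= s / h by rewrite divr_ge0// ltW.
by rewrite /grid_left /grid_right -ler_pdivlMr// h1 -ltr_pdivrMr.
Qed.

Lemma grid_rightE (h s : R) : grid_right h s = grid_left h s + h.
Proof. by rewrite /grid_left /grid_right -natr1 mulrDl mul1r. Qed.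

Lemma truncn_grid (h s : R) k : 0 < h -> k%:R * h <= s < k.+1%:R * h ->
  Num.truncn (s / h) = k.
Proof.
move=> h0 /andP[h1 h2].
by apply: truncn_def; rewrite ler_pdivlMr// h1 ltr_pdivrMr.
Qed.

(** The function is constant on each of the countably many grid cells. *)
Lemma measurable_fun_grid (h : R) (g : nat -> R) : 0 < h ->
  measurable_fun [set` `[(0 : R), +oo[ ] (fun s => g (Num.truncn (s / h))).
Proof.
move=> h0.
have sub : [set` `[(0 : R), +oo[ ] `<=` \bigcup_k [set` `[k%:R * h, k.+1%:R * h[].
  move=> s /=; rewrite in_itv/= andbT => s0; exists (Num.truncn (s / h)) => //=.
  by rewrite in_itv/= grid_itv.
apply: measurable_funS sub _; first exact: bigcup_measurable.
apply/measurable_fun_bigcup => // k.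
apply: (eq_measurable_fun (cst (g k))); last exact: measurable_cst.
by move=> s; rewrite inE/= in_itv/= => /(truncn_grid h0) ->.
Qed.

Lemma cvg_grid_right (h : nat -> R) (f : R -> R) s : (forall n, 0 < h n) ->
  h n @[n --> \oo] --> 0 -> 0 <= s -> f u @[u --> s^'+] --> f s ->
  f (grid_right (h n) s) @[n --> \oo] --> f s.
Proof.
move=> h0 hcvg s0 rc; apply/cvgrPdist_lt => e e0.
have [d /= d0 Hd] : nbhs s^'+ (fun u => `|f s - f u| < e).
  exact: (cvgr_dist_lt _ _ rc).
near=> n; have /andP[gl gr] := grid_itv (h0 n) s0.
apply: Hd => //=.
have hnd : h n < d.
  have : `|0 - h n| < d by near: n; exact: (cvgr_dist_lt _ _ hcvg).
  by rewrite sub0r normrN gtr0_norm.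
by rewrite ltr0_norm ?subr_lt0// opprB grid_rightE; lra.
Unshelve. all: end_near. Qed.

(** By right continuity, [f] is the pointwise limit of its step approximations
    [f (grid_right (1 / n.+1) s)]. *)
Lemma real_cadlag_measurable (f : R -> R) : real_cadlag f ->
  measurable_fun [set` `[(0 : R), +oo[ ] f.
Proof.
move=> cf; pose h n : R := n.+1%:R^-1.
apply: (@measurable_realfun.measurable_fun_cvg _ _ _ _ (fun n s => f (grid_right (h n) s))).
  move=> n; apply: (measurable_fun_grid (fun k => f (k.+1%:R * h n))).
  by rewrite invr_gt0.
move=> s /=; rewrite in_itv/= andbT => s0.
apply: cvg_grid_right => //; last by case: (cf _ s0).
- by move=> n; rewrite invr_gt0.
- exact: cvg_harmonic.
Qed.

Lemma real_cadlag_integrable (f : R -> R) (a b : R) : 0 <= a -> real_cadlag f ->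
  mu.-integrable `[a, b] (EFin \o f).
Proof.
move=> a0 cf; have [M [M0 HM]] := real_cadlag_bounded b cf.
apply: measurable_bounded_integrable => //.
- by rewrite /= lebesgue_measure_itv/=; case: ifP => // _; rewrite -EFinB ltry.
- apply: measurable_funS (real_cadlag_measurable cf) => //.
  by move=> s /=; rewrite !in_itv/= andbT => /andP[/(le_trans a0)].
- exists M; split; first exact: num_real.
  move=> N MN s /=; rewrite in_itv/= => /andP[as_ sb]; apply: le_trans (ltW MN).
  by apply: HM; rewrite sb (le_trans a0).
Qed.

End regulated.

(** * Riemann sums with an exponential integrand *)

Section riemann_exp.
Context {R : realType}.
Notation mu := (@lebesgue_measure R).
Variables (lambda c : R) (f j : R -> R).
Hypothesis lambda_gt0 : 0 < lambda.
Hypothesis f_cadlag : real_cadlag f.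
Hypothesis jE : forall s, 0 <= s ->
  j s = f s - c + lambda * \int[mu]_(u in `[0, s]) f u.

(** Summation by parts evaluates the two factors on different sides of a grid
    cell: the drift of [j] carries the exponential of the left end, while the
    increments of the exponential carry [f] at the right end. *)
Let defect (h s : R) : R :=
  expR (lambda * grid_left h s) * f s - expR (lambda * s) * f (grid_right h s).

Let measurable_defect (h : R) : 0 < h ->
  measurable_fun [set` `[(0 : R), +oo[ ] (defect h).
Proof.
move=> h0; apply: measurable_funB; apply: measurable_funM.
- exact: (measurable_fun_grid (fun k => expR (lambda * (k%:R * h)))).
- exact: real_cadlag_measurable.
- apply: (@measurableT_comp _ _ _ _ _ _ expR); first exact: measurable_expR.
  exact: measurable_funM.
- exact: (measurable_fun_grid (fun k => f (k.+1%:R * h))).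
Qed.

Let defect_le (h b M s : R) : 0 < h -> 0 <= M ->
  (forall u, 0 <= u <= b -> `|f u| <= M) -> 0 <= s -> grid_right h s <= b ->
  `|defect h s| <= 2 * expR (lambda * b) * M.
Proof.
move=> h0 M0 HM s0 sb; have /andP[gl gr] := grid_itv h0 s0.
have gr0 : 0 <= grid_right h s by apply: le_trans (ltW gr).
rewrite (le_trans (ler_normB _ _))// !normrM !(ger0_norm (expR_ge0 _)) -mulrA mulr2n mulrDl mul1r.
apply: lerD; apply: ler_pM => //; rewrite ?expR_ge0 ?ler_expR ?ler_pM2l//.
- lra.
- by apply: HM; rewrite s0 (le_trans (ltW gr)).
- lra.
- by apply: HM; rewrite gr0.
Qed.

Let integrable_defect (h b : R) : 0 < h ->
  mu.-integrable `[0, b[ (EFin \o defect h).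
Proof.
move=> h0; have [M [M0 HM]] := real_cadlag_bounded (b + h) f_cadlag.
apply: measurable_bounded_integrable => //.
- by rewrite /= lebesgue_measure_itv/=; case: ifP => // _; rewrite -EFinB ltry.
- apply: measurable_funS (measurable_defect h0) => //.
  by move=> s /=; rewrite !in_itv/= andbT => /andP[].
- exists (2 * expR (lambda * (b + h)) * M); split; first exact: num_real.
  move=> N MN s /=; rewrite in_itv/= => /andP[s0 sb]; apply: le_trans (ltW MN).
  apply: defect_le => //; rewrite grid_rightE.
  by have /andP[? _] := grid_itv h0 s0; lra.
Qed.

Let integral_defect_cell (h : R) k : 0 < h ->
  lambda * \int[mu]_(s in `[k%:R * h, k.+1%:R * h[) defect h s =
  expR (lambda * (k%:R * h)) * (j (k.+1%:R * h) - j (k%:R * h))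
  - (expR (lambda * (k.+1%:R * h)) * f (k.+1%:R * h)
     - expR (lambda * (k%:R * h)) * f (k%:R * h)).
Proof.
move=> h0; set a := k%:R * h; set b := k.+1%:R * h.
have a0 : 0 <= a by rewrite mulr_ge0// ltW.
have ab : a < b by rewrite ltr_pM2r// ltr_nat.
have b0 := le_trans a0 (ltW ab).
have sub : [set` `[a, b[ ] `<=` [set` `[a, b] ].
  by move=> s /=; rewrite !in_itv/= => /andP[-> /ltW].
have if_ : mu.-integrable `[a, b[ (EFin \o f).
  by apply: (@integrableS _ _ _ mu `[a, b] `[a, b[) => //; exact: real_cadlag_integrable.
have ie : mu.-integrable `[a, b[ (EFin \o (fun s => expR (lambda * s))).
  by apply: (@integrableS _ _ _ mu `[a, b] `[a, b[) => //; exact: integrable_expR_scaled.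
have -> : \int[mu]_(s in `[a, b[) defect h s =
    \int[mu]_(s in `[a, b[) (expR (lambda * a) * f s - expR (lambda * s) * f b).
  apply: eq_Rintegral => s; rewrite inE/= in_itv/= => /(truncn_grid h0) sk.
  by rewrite /defect /grid_left /grid_right sk.
rewrite RintegralB//; last 2 first.
- rewrite (_ : _ \o _ = (fun s => (expR (lambda * a))%:E * (EFin \o f) s)%E)//.
  exact: integrableZl.
- rewrite (_ : _ \o _ = (fun s => (EFin \o (fun s => expR (lambda * s))) s * (f b)%:E)%E)//.
  exact: integrableZr.
rewrite RintegralZl// RintegralZr// !Rintegral_itv_bndo_bndc//.
have Ef : \int[mu]_(s in `[a, b]) f s =
    \int[mu]_(s in `[0, b]) f s - \int[mu]_(s in `[0, a]) f s.
  rewrite Rintegral_itvB ?bnd_simp//; last 2 first.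
  - exact: real_cadlag_integrable.
  - exact: ltW.
  rewrite Rintegral_itv_obnd_cbnd//;
  apply: integrableS (real_cadlag_integrable b a0 f_cadlag) => //.
  by move=> s /=; rewrite !in_itv/= => /andP[/ltW -> ->].
have Ee : lambda * \int[mu]_(s in `[a, b]) expR (lambda * s) =
    expR (lambda * b) - expR (lambda * a).
  rewrite -RintegralZl//; last exact: integrable_expR_scaled.
  by rewrite Rintegral_expR_scaled// ltW.
rewrite !jE// Ef mulrBr mulrA [lambda * (_ * f b)]mulrA Ee; ring.
Qed.

(** Discrete integration by parts. The [f] part of the increment of [j]
    telescopes after multiplication by the exponential weight, leaving the
    increments of that weight times the right values of [f]; these increments
    and the drift part of [j] are both integrals over the grid cells, whose
    difference is the integral of [defect]. *)
Lemma riemann_grid (h : R) m : 0 < h ->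
  \sum_(0 <= k < m) expR (lambda * (k%:R * h)) * (j (k.+1%:R * h) - j (k%:R * h)) =
  expR (lambda * (m%:R * h)) * f (m%:R * h) - f 0
  + lambda * \int[mu]_(s in `[0, m%:R * h[) defect h s.
Proof.
move=> h0; elim: m => [|m IH].
  rewrite big_geq// !mul0r mulr0 expR0 mul1r subrr set_itv_ge ?bnd_simp ?ltxx//.
  by rewrite Rintegral_set0 mulr0 addr0.
have mm : m%:R * h <= m.+1%:R * h by rewrite ler_pM2r// ler_nat.
have m0 : 0 <= m%:R * h by rewrite mulr_ge0// ltW.
rewrite big_nat_recr//= IH.
rewrite [in RHS](@itv_bndbnd_setU _ _ (BLeft 0) (BLeft (m%:R * h))) ?bnd_simp//.
rewrite Rintegral_setU//=; last 2 first.
- by rewrite -itv_bndbnd_setU ?bnd_simp//; exact: integrable_defect.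
- rewrite disj_set2E; apply/eqP; rewrite -subset0 => s [] /=.
  by rewrite !in_itv/= => /andP[_ sm] /andP[/le_lt_trans/(_ sm)]; rewrite ltxx.
rewrite [lambda * (_ + _)]mulrDr integral_defect_cell//; ring.
Qed.

Lemma cvg_riemann_grid (t : R) : 0 < t ->
  \sum_(0 <= k < n.+1)
    expR (lambda * (k%:R * (t / n.+1%:R)))
    * (j (k.+1%:R * (t / n.+1%:R)) - j (k%:R * (t / n.+1%:R)))
  @[n --> \oo] --> expR (lambda * t) * f t - f 0.
Proof.
move=> t0; pose h n : R := t / n.+1%:R.
have h0 n : 0 < h n by rewrite divr_gt0.
have mh n : n.+1%:R * h n = t by rewrite mulrC divfK.
have h_cvg : h n @[n --> \oo] --> (0 : R).
  rewrite -[0](mulr0 t); apply: cvgMr; exact: cvg_harmonic.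
rewrite [X in X @ _ --> _](_ : _ = fun n => expR (lambda * t) * f t - f 0 +
    lambda * \int[mu]_(s in `[0, t[) defect (h n) s); last first.
  by apply/funext => n; have := riemann_grid n.+1 (h0 n); rewrite mh.
rewrite -[X in _ --> X]addr0; apply: cvgD; first exact: cvg_cst.
rewrite -[X in _ --> X](mulr0 lambda); apply: cvgMr.
have [M [M0 HM]] := real_cadlag_bounded t f_cadlag.
have mI : measurable [set` `[(0 : R), t[ ] by [].
have : (\int[mu]_(s in `[0%R, t[) (defect (h n) s)%:E)%E @[n --> \oo] -->
       (\int[mu]_(s in `[0%R, t[) (cst 0%E s))%E.
  apply: (@dominated_cvg _ _ _ mu _ mI (fun n s => (defect (h n) s)%:E) _
    (cst (2 * expR (lambda * t) * M)%:E)) => //.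
  - move=> n; apply/measurable_EFinP.
    apply: measurable_funS (measurable_defect (h0 n)) => //.
    by move=> s /=; rewrite !in_itv/= andbT => /andP[].
  - move=> s /=; rewrite in_itv/= => /andP[s0 st]; apply: cvg_EFin; first exact: nearW.
    rewrite /= -(subrr (expR (lambda * s) * f s)); apply: cvgB; last first.
      apply: cvgMr; apply: cvg_grid_right => //; by case: (f_cadlag s0).
    apply: cvgMl.
    apply: (@cvg_comp _ _ _ (fun n => lambda * grid_left (h n) s) expR _
      (nbhs (lambda * s))); last exact: continuous_expR.
    apply: cvgMr; apply/cvgrPdist_lt => e e0; near=> n.
    have /andP[gl gr] := grid_itv (h0 n) s0.
    have hnd : h n < e.
      have : `|0 - h n| < e by near: n; exact: (cvgr_dist_lt _ _ h_cvg).
      by rewrite sub0r normrN gtr0_norm.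
    by rewrite ger0_norm ?subr_ge0//; move: gr; rewrite grid_rightE; lra.
  - apply: (measurable_bounded_integrable (f := cst (2 * expR (lambda * t) * M))) => //.
      by rewrite /= lebesgue_measure_itv/=; case: ifP => // _; rewrite -EFinB ltry.
    by exists (2 * expR (lambda * t) * M); split; [exact: num_real|
      move=> N MN s _; rewrite /= ger0_norm ?(ltW MN)// !mulr_ge0// expR_ge0].
  - move=> n s /=; rewrite in_itv/= => /andP[s0 st]; rewrite lee_fin.
    apply: defect_le => //; rewrite -(mh n) /grid_right ler_pM2r// ler_nat.
    rewrite -(ltr_nat R); have /andP[gl _] := grid_itv (h0 n) s0.
    by rewrite -(ltr_pM2r (h0 n)) mh (le_lt_trans gl).
rewrite integral0 => /fine_cvg.
exact.
Unshelve. all: end_near. Qed.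

End riemann_exp.

(** * Convergence in the complex plane *)

Section complex_convergence.
Context {R : realType}.
Implicit Types (x : R -> Cplx R).

Lemma normc_ge_Im (z : R[i]) : `|complex.Im z|%:C <= `|z|.
Proof. by rewrite normc_def lecR -sqrtr_sqr ler_wsqrtr// lerDr sqr_ge0. Qed.

Lemma Re_affine (x y z : Cplx R) (r : R) :
  complex.Re (x + y - r%:C * z) = complex.Re x + complex.Re y - r * complex.Re z.
Proof. by case: x y z => [? ?] [? ?] [? ?] /=; ring. Qed.

Lemma Im_affine (x y z : Cplx R) (r : R) :
  complex.Im (x + y - r%:C * z) = complex.Im x + complex.Im y - r * complex.Im z.
Proof. by case: x y z => [? ?] [? ?] [? ?] /=; ring. Qed.

Lemma Re_sum_real_mul (I : Type) (r : seq I) (a : I -> R) (z : I -> Cplx R) :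
  complex.Re (\sum_(i <- r) (a i)%:C * z i) = \sum_(i <- r) a i * complex.Re (z i).
Proof.
elim: r => [|i r IH]; first by rewrite !big_nil.
rewrite !big_cons -IH; case: (z i) => u v; case: (\sum_(_ <- _) _) => x y /=.
by rewrite mul0r subr0.
Qed.

Lemma Im_sum_real_mul (I : Type) (r : seq I) (a : I -> R) (z : I -> Cplx R) :
  complex.Im (\sum_(i <- r) (a i)%:C * z i) = \sum_(i <- r) a i * complex.Im (z i).
Proof.
elim: r => [|i r IH]; first by rewrite !big_nil.
rewrite !big_cons -IH; case: (z i) => u v; case: (\sum_(_ <- _) _) => x y /=.
by rewrite mul0r addr0.
Qed.

Lemma cvg_Re {T} {F : set_system T} {FF : Filter F} (f : T -> Cplx R) (l : Cplx R) :
  f @ F --> l -> (fun u => complex.Re (f u)) @ F --> complex.Re l.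
Proof.
move=> /cvgrPdist_lt fl; apply/cvgrPdist_lt => e e0.
have e0C : 0 < e%:C by rewrite ltcR.
near=> u; rewrite -ltcR.
have : `|l - f u| < e%:C by near: u; exact: fl.
by apply: le_lt_trans; rewrite -raddfB/=; exact: normc_ge_Re.
Unshelve. all: end_near. Qed.

Lemma cvg_Im {T} {F : set_system T} {FF : Filter F} (f : T -> Cplx R) (l : Cplx R) :
  f @ F --> l -> (fun u => complex.Im (f u)) @ F --> complex.Im l.
Proof.
move=> /cvgrPdist_lt fl; apply/cvgrPdist_lt => e e0.
have e0C : 0 < e%:C by rewrite ltcR.
near=> u; rewrite -ltcR.
have : `|l - f u| < e%:C by near: u; exact: fl.
by apply: le_lt_trans; rewrite -raddfB/=; exact: normc_ge_Im.
Unshelve. all: end_near. Qed.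

Lemma cvg_real_complex {T} {F : set_system T} {FF : Filter F} (f : T -> R) (l : R) :
  f @ F --> l -> (fun u => (f u)%:C : Cplx R) @ F --> (l%:C : Cplx R).
Proof.
move=> /cvgrPdist_lt fl; apply/cvgrPdist_lt => e; rewrite ltcE /= => /andP[/eqP eI eR].
near=> u; have : `|l - f u| < complex.Re e by near: u; exact: fl.
rewrite -rmorphB/= normc_def/= expr0n addr0 sqrtr_sqr ltcE /= eI eqxx.
exact.
Unshelve. all: end_near. Qed.

Lemma cadlag_Re x : cadlag x -> real_cadlag (fun s => complex.Re (x s)).
Proof.
move=> cx t t0; have [rc ll] := cx t t0; split; first exact: cvg_Re.
by move=> /ll /cvg_ex[l xl]; apply/cvg_ex; exists (complex.Re l); exact: cvg_Re.
Qed.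

Lemma cadlag_Im x : cadlag x -> real_cadlag (fun s => complex.Im (x s)).
Proof.
move=> cx t t0; have [rc ll] := cx t t0; split; first exact: cvg_Im.
by move=> /ll /cvg_ex[l xl]; apply/cvg_ex; exists (complex.Im l); exact: cvg_Im.
Qed.

(** Extends an identity from positive rational times to all times. *)
Lemma right_continuous_eq0 (f : R -> Cplx R) (t : R) : 0 <= t ->
  f u @[u --> t^'+] --> f t -> (forall q : rat, 0 < q -> f (ratr q) = 0) ->
  f t = 0.
Proof.
move=> t0 /cvgrPdist_lt rc fq; apply/eqP/negPn/negP => ft0.
have ft_gt0 : 0 < `|f t| by rewrite normr_gt0.
have [d /= d0 Hd] := rc _ ft_gt0.
have /rat_in_itvoo[q] : t < t + d by rewrite ltrDl.
rewrite in_itv/= => /andP[tq qd].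
have : `|f t - f (ratr q)| < `|f t|.
  by apply: Hd => //=; rewrite ltr0_norm ?subr_lt0// opprB; lra.
by rewrite fq ?subr0 ?ltxx// -(ltr0q R) (le_lt_trans t0).
Qed.

End complex_convergence.

(** * Winding of time-changed paths *)

Section time_changed_winding.
Context {R : realType}.
Implicit Types (x y : R -> Cplx R).

(** An increasing bijection of the half-line, with its inverse. Continuity is
    two-sided also at [0], which spares a special treatment of that point. *)
Record time_change (h g : R -> R) : Prop := {
  time_change0 : h 0 = 0;
  time_changeK : forall s, 0 <= s -> 0 <= h s /\ g (h s) = s;
  time_changeVK : forall s, 0 <= s -> 0 <= g s /\ h (g s) = s;
  time_change_le : forall s s', 0 <= s -> 0 <= s' -> (h s <= h s') = (s <= s');
  time_change_continuous : forall s, 0 <= s -> {for s, continuous h};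
  time_changeV_continuous : forall s, 0 <= s -> {for s, continuous g} }.

Lemma time_change_sym (h g : R -> R) : time_change h g -> time_change g h.
Proof.
move=> [h0 hK gK h_le h_cont g_cont]; split => //.
- by have [] := hK 0 (lexx 0); rewrite h0.
- by move=> s s' s0 s'0; have [gs0 hgs] := gK s s0; have [gs'0 hgs'] := gK s' s'0;
    rewrite -(h_le (g s) (g s'))// hgs hgs'.
Qed.

Lemma time_change_at_right (h g : R -> R) (s : R) : time_change h g -> 0 <= s ->
  h u @[u --> s^'+] --> (h s)^'+.
Proof.
move=> [_ _ _ h_le h_cont _] s0 A [d /= d0 HA].
have hs : h u @[u --> s] --> h s by exact: h_cont.
have near_d : \forall u \near s^'+, `|h s - h u| < d.
  by apply: cvg_within; exact: (cvgr_dist_lt _ _ hs).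
have near_gt : \forall u \near s^'+, s < u := nbhs_right_gt _.
change (\forall u \near s^'+, A (h u)); near=> u.
have su : s < u by near: u; exact: near_gt.
have u0 : 0 <= u by rewrite (le_trans s0)// ltW.
by apply: HA => /=; [near: u; exact: near_d|rewrite ltNge h_le// -ltNge].
Unshelve. all: end_near. Qed.

Lemma time_change_at_left (h g : R -> R) (s : R) : time_change h g -> 0 < s ->
  h u @[u --> s^'-] --> (h s)^'-.
Proof.
move=> [_ _ _ h_le h_cont _] s0 A [d /= d0 HA].
have hs : h u @[u --> s] --> h s by apply: h_cont; exact: ltW.
have near_d : \forall u \near s^'-, `|h s - h u| < d.
  by apply: cvg_within; exact: (cvgr_dist_lt _ _ hs).
have near_lt : \forall u \near s^'-, u < s := nbhs_left_lt _.
have near_ge0 : \forall u \near s^'-, 0 <= u := nbhs_left_ge s0.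
change (\forall u \near s^'-, A (h u)); near=> u.
have us : u < s by near: u; exact: near_lt.
have u0 : 0 <= u by near: u; exact: near_ge0.
by apply: HA => /=; [near: u; exact: near_d|rewrite ltNge h_le ?(ltW s0)// -ltNge].
Unshelve. all: end_near. Qed.

(** If [gamma] fills in the jumps of [x] along [r], then [k (r p) * gamma p] fills
    in those of [y] along [h (r p)], with the same positions on the segments
    and the same continuous argument, since [k] is positive. *)
Lemma is_winding_time_change x y (h g k : R -> R) (t v : R) :
  time_change h g -> 0 <= t ->
  (forall s, 0 <= s -> {for s, continuous k}) ->
  (forall s, 0 <= s -> 0 < k s) ->
  (forall s, 0 <= s -> y (h s) = (k s)%:C * x s) ->
  (forall s, 0 <= s -> left_limit y (h s) = (k s)%:C * left_limit x s) ->
  is_winding x t v -> is_winding y (h t) v.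
Proof.
move=> [h0 _ _ h_mono h_cont _] t0 k_cont k_gt0 yE yE_left.
move=> [gamma [phi [fill gamma_neq0 [phi_cont gammaE] vE]]].
have [r [q [[r_cont r0 r1] [[r_homo q01 q_homo] [gamma_cont gamma_seg gamma1]]]]] := fill.
have in0 : (0 : R) \in `[0, 1] by rewrite in_itv/= lexx ler01.
have r_ge0 p : p \in `[0, 1] -> 0 <= r p.
  move=> p01; rewrite -r0; apply: r_homo => //.
  by move: p01; rewrite in_itv => /andP[].
have comp_cont (f : R -> R) : (forall s, 0 <= s -> {for s, continuous f}) ->
    {within `[0, 1], continuous (f \o r)}.
  move=> f_cont; apply/subspace_continuousP => p p01.
  apply: (@cvg_comp _ _ _ r f _ (nbhs (r p))).
    by move/subspace_continuousP : r_cont; exact.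
  exact/f_cont/r_ge0.
exists (fun p => (k (r p))%:C * gamma p), phi; split => //.
- exists (h \o r), q; split; first by split; [exact: comp_cont|rewrite /= r0|rewrite /= r1].
  split; first split => //.
  + by move=> p p' p01 p'01 pp' /=; rewrite h_mono ?r_ge0// r_homo.
  + move=> p p' p01 p'01 pp' /= /eqP; rewrite eq_le !h_mono ?r_ge0// -eq_le => /eqP.
    exact: q_homo.
  split.
  + apply/subspace_continuousP => p p01; apply: cvgM.
      apply: cvg_real_complex.
      by move/subspace_continuousP : (comp_cont _ k_cont); exact.
    by move/subspace_continuousP : gamma_cont; exact.
  + move=> p p01; rewrite /= yE_left ?yE ?r_ge0// gamma_seg//; ring.
  + by rewrite gamma1 r1 -yE.
- move=> p p01; rewrite mulf_neq0 ?gamma_neq0//.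
  by rewrite gt_eqF// ltcR k_gt0// r_ge0.
- split => // p p01; rewrite normrM ger0_norm; last first.
    by rewrite lecR ltW// k_gt0// r_ge0.
  by rewrite -mulrA -gammaE.
Qed.

Lemma left_limit_time_change x y (h g k : R -> R) (s : R) :
  time_change h g -> 0 <= s ->
  (forall u, 0 <= u -> {for u, continuous k}) ->
  (forall u, 0 <= u -> y (h u) = (k u)%:C * x u) ->
  cadlag x ->
  left_limit y (h s) = (k s)%:C * left_limit x s.
Proof.
move=> hg s0 k_cont yE cx; rewrite /left_limit.
have [h0 hK gK h_le _ _] := hg.
have hs_le0 : (h s <= 0) = (s <= 0) by rewrite -{1}h0 h_le.
rewrite hs_le0; have [s_le0|s_gt0] := leP s 0.
  have -> : s = 0 by apply/eqP; rewrite eq_le s_le0.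
  by rewrite -{1}h0 yE.
have [_ /(_ s_gt0) /cvg_ex[l xl]] := cx _ s0.
have -> : lim (x u @[u --> s^'-]) = l by exact/cvg_lim.
have hs_gt0 : 0 < h s by rewrite ltNge hs_le0 -ltNge.
have g_left : g u @[u --> (h s)^'-] --> s^'-.
  have := time_change_at_left (time_change_sym hg) hs_gt0.
  by have [_ ->] := hK _ s0.
have lim_x : ((k (g u))%:C * x (g u) : Cplx R) @[u --> (h s)^'-] -->
    ((k s)%:C * l : Cplx R).
  apply: cvgM; last exact: (@cvg_comp _ _ _ g x _ _ _ g_left xl).
  apply: cvg_real_complex; apply: (@cvg_comp _ _ _ g k _ _ _ g_left).
  exact/cvg_at_left_filter/k_cont.
suff y_lim : y u @[u --> (h s)^'-] --> ((k s)%:C * l : Cplx R) by exact/cvg_lim.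
apply: cvg_trans lim_x; apply: near_eq_cvg; near=> u.
have u0 : 0 <= u by near: u; exact: nbhs_left_ge.
by have [gu0 hgu] := gK _ u0; rewrite -yE// hgu.
Unshelve. all: end_near. Qed.

(** The reverse inclusion applies the same reparametrisation to the inverse
    change of time, with factor [1 / k (g s)]. *)
Lemma winding_time_change x y (h g k : R -> R) (t : R) :
  time_change h g -> 0 <= t ->
  (forall s, 0 <= s -> {for s, continuous k}) ->
  (forall s, 0 <= s -> 0 < k s) ->
  (forall s, 0 <= s -> y (h s) = (k s)%:C * x s) ->
  cadlag x ->
  winding x t = winding y (h t).
Proof.
move=> hg t0 k_cont k_gt0 yE cx; have [h0 hK gK h_le h_cont g_cont] := hg.
have yE_left s (s0 : 0 <= s) := left_limit_time_change hg s0 k_cont yE cx.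
congr xget; apply/seteqP; split => v /=.
  exact: (is_winding_time_change hg t0 k_cont k_gt0 yE yE_left).
(* The converse: [x] is recovered from [y] by the inverse change of time. *)
have kC_neq0 s : 0 <= s -> (k s)%:C != 0 :> R[i].
  by move=> s0; rewrite gt_eqF// ltcR k_gt0.
have [ht0 ght] := hK _ t0; rewrite -{2}ght.
apply: (is_winding_time_change (k := fun s => (k (g s))^-1) (time_change_sym hg) ht0).
- move=> s s0; have [gs0 _] := gK _ s0.
  apply: cvgV; first by rewrite gt_eqF ?k_gt0.
  apply: (@cvg_comp _ _ _ g k _ (nbhs (g s))); [exact: g_cont|exact: k_cont].
- by move=> s s0; rewrite invr_gt0 k_gt0//; have [] := gK _ s0.
- move=> s s0; have [gs0 hgs] := gK _ s0.
  by rewrite -{3}hgs yE// fmorphV mulKf// kC_neq0.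
- move=> s s0; have [gs0 hgs] := gK _ s0.
  by rewrite -{3}hgs yE_left// fmorphV mulKf// kC_neq0.
Qed.

Lemma time_changed_path_eq (x y : R -> Cplx R) (h g k : R -> R) :
  time_change h g -> cadlag x -> cadlag y ->
  (forall t, 0 <= t -> {for t, continuous k}) ->
  (forall q : rat, 0 < q -> y (h (ratr q)) = (k (ratr q))%:C * x (ratr q)) ->
  forall t, 0 <= t -> y (h t) = (k t)%:C * x t.
Proof.
move=> hg cx cy k_cont yq t t0; have [_ hK _ _ _ _] := hg.
have [rx _] := cx _ t0; have [ry _] := cy _ (hK _ t0).1.
apply/subr0_eq.
apply: (right_continuous_eq0 (f := fun s => y (h s) - (k s)%:C * x s) t0).
  apply: cvgB; first exact: (@cvg_comp _ _ _ h y _ _ _ (time_change_at_right hg t0) ry).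
  apply: cvgM rx; apply: cvg_real_complex.
  exact/cvg_at_right_filter/k_cont.
by move=> q q0; rewrite yq// subrr.
Qed.

End time_changed_winding.

(** * Limits in probability and almost sure limits *)

Section limit_in_probability.
Context {d : measure_display} {T : measurableType d} {R : realType}.
Variable P : probability T R.

(** If [eps < Y w] and [Z n w] tends to [Y w], then [w] lies in all but finitely
    many of the sets [eps < Z n], hence in one of countably many tail
    intersections, each of which is null because the measures of these sets
    tend to [0]. *)
Lemma ae_le0_of_cvg_in_probability (Z : nat -> T -> R) (Y : T -> R) :
  (forall n, measurable_fun setT (Z n)) ->
  {ae P, forall w, Z n w @[n --> \oo] --> Y w} ->
  (forall eps, 0 < eps -> P [set w | eps < Z n w] @[n --> \oo] --> 0%E) ->
  {ae P, forall w, Y w <= 0}.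
Proof.
move=> mZ ZY ZP.
pose E k n := [set w | k.+1%:R^-1 < Z n w].
have mE k n : measurable (E k n).
  rewrite -[E k n]setTI; have := mZ n measurableT [set` `]k.+1%:R^-1, +oo[ ].
  rewrite (_ : Z n @^-1` _ = E k n); first exact.
  by apply/seteqP; split => w /=; rewrite in_itv/= andbT.
pose D k m := \bigcap_(n in [set n | (m <= n)%N]) E k n.
have mD k m : measurable (D k m).
  by apply: bigcap_measurable => //; exists m => /=.
have D0 k m : P.-negligible (D k m).
  apply/negligibleP => //; apply/eqP; rewrite eq_le measure_ge0 andbT.
  have k0 : (0 : R) < k.+1%:R^-1 by rewrite invr_gt0.
  have PE := ZP _ k0; rewrite -(cvg_lim _ PE)//.
  apply: lime_ge; first by apply/cvg_ex; exists 0%E.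
  exists m => // n /= mn; apply: le_measure; [exact/mem_set/mD|exact/mem_set/mE|].
  by move=> w; apply.
have [N [mN N0 ZN]] := ZY.
have : P.-negligible (N `|` \bigcup_k \bigcup_m D k m).
  apply: negligibleU; first by apply/negligibleP.
  by apply: negligible_bigcup => k; apply: negligible_bigcup.
apply: negligibleS => w /= /negP; rewrite -ltNge => Yw0.
have [Zw|nZw] := pselect (Z n w @[n --> \oo] --> Y w); last by left; apply: ZN.
right; have [k kY] : exists k, k.+1%:R^-1 < Y w.
  have /cvgrPdist_lt/(_ _ Yw0)[k _ /(_ k (leqnn _))] := @cvg_harmonic R.
  by rewrite /= sub0r normrN ger0_norm ?invr_ge0// => kY; exists k.
exists k => //; move/cvgrPdist_lt : Zw => /(_ (Y w - k.+1%:R^-1)).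
rewrite subr_gt0 => /(_ kY)[m _ Hm]; exists m => // n /= mn.
by have := Hm n mn; rewrite /= ltr_distlC subKr => /andP[].
Qed.

Lemma ae_forall_rat (Q : rat -> T -> Prop) :
  (forall q, {ae P, forall w, Q q w}) -> {ae P, forall w, forall q, Q q w}.
Proof.
move=> aeQ.
have : {ae P, forall w, forall n : nat, if unpickle n is Some q then Q q w else True}.
  by apply: ae_foralln => n; case: unpickle => [q|]; [exact: aeQ|exact: aeW].
by apply: filterS => w Qw q; have := Qw (pickle q); rewrite pickleK.
Qed.

End limit_in_probability.

(** * The exponential integral of the driving noise *)

Section uniform_partition.
Context {R : realType}.

Definition uniform_partition (t : R) (n : nat) : seq R :=
  mkseq (fun k => k.+1%:R * (t / n.+1%:R)) n.+1.

Lemma nth_uniform_partition (b t : R) (n k : nat) : (k < n.+1)%N ->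
  nth b (uniform_partition t n) k = k.+1%:R * (t / n.+1%:R) /\
  nth b (0 :: uniform_partition t n) k = k%:R * (t / n.+1%:R).
Proof.
move=> kn; split; first by rewrite nth_mkseq.
by case: k kn => [|k] kn /=; rewrite ?mul0r// nth_mkseq// ltnW.
Qed.

Lemma itv_partition_uniform (t : R) (n : nat) : 0 < t ->
  itv_partition 0 t (uniform_partition t n).
Proof.
move=> t0; have h0 : 0 < t / n.+1%:R by rewrite divr_gt0.
split; last first.
  rewrite (last_nth 0) size_mkseq -nth_behead /= nth_mkseq//.
  by rewrite mulrC divfK.
apply/(pathP t) => k; rewrite size_mkseq => kn.
have [-> ->] := nth_uniform_partition t t kn.
by rewrite ltr_pM2r// ltr_nat.
Qed.

Lemma cvg_mesh_uniform (t : R) : 0 < t ->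
  mesh 0 t (uniform_partition t n) @[n --> \oo] --> (0 : R).
Proof.
move=> t0.
have h_cvg : t / n.+1%:R @[n --> \oo] --> (0 : R).
  rewrite -[X in _ --> X](mulr0 t); apply: cvgMr; exact: cvg_harmonic.
apply: (squeeze_cvgr _ (cvg_cst 0) h_cvg); apply: nearW => n.
have h0 : 0 < t / n.+1%:R by rewrite divr_gt0.
rewrite /mesh size_mkseq big_nat.
apply: (big_ind (fun x => 0 <= x <= t / n.+1%:R)).
- by rewrite lexx ltW.
- by move=> x y /andP[x0 x1] /andP[y0 y1]; rewrite le_max x0 ge_max x1 y1.
- move=> k /andP[_ kn]; have [-> ->] := nth_uniform_partition t t kn.
  by rewrite -mulrBl -natrB// subSnn mul1r lexx ltW.
Qed.

End uniform_partition.

Section ornstein_uhlenbeck_integral.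
Context {d : measure_display} {T : measurableType d} {R : realType}.
Variable P : probability T R.
Implicit Types (J V I : R -> T -> Cplx R).

Lemma riemann_sum_uniform (f : R -> R) J (t : R) (n : nat) (w : T) :
  riemann_sum f J 0 t (uniform_partition t n) w =
  \sum_(0 <= k < n.+1) (f (k%:R * (t / n.+1%:R)))%:C *
    (J (k.+1%:R * (t / n.+1%:R)) w - J (k%:R * (t / n.+1%:R)) w).
Proof.
rewrite /riemann_sum size_mkseq; apply: eq_big_nat => k /andP[_ kn].
by have [-> ->] := nth_uniform_partition t t kn.
Qed.

Lemma measurable_Re_process J (t : R) : complex_process J -> 0 <= t ->
  measurable_fun setT (fun w => complex.Re (J t w)).
Proof. by move=> mJ /mJ; exact: (measurableT_comp measurable_fst). Qed.

Lemma measurable_Im_process J (t : R) : complex_process J -> 0 <= t ->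
  measurable_fun setT (fun w => complex.Im (J t w)).
Proof. by move=> mJ /mJ; exact: (measurableT_comp measurable_snd). Qed.

(** The distance [Z n] of the Riemann sums to [I t] tends to [0] in probability
    and almost surely to the distance [Y] between the two sides. Real and
    imaginary parts are treated separately, as [cvg_riemann_grid] is about real
    functions. *)
Lemma ou_exp_integral (alpha lambda : R) (v0 : Cplx R) J V I (t : R) :
  0 < lambda -> 0 < t -> isotropic_stable P alpha 0 J ->
  ornstein_uhlenbeck P lambda v0 J V ->
  is_stochastic_integral P (fun s => expR (lambda * s)) J I ->
  {ae P, forall w, (expR (lambda * t))%:C * V t w = v0 + I t w}.
Proof.
move=> l0 t0 J_stable V_ou [mI I_lim].
have mJ := stable_process J_stable.
pose node n k : R := k%:R * (t / n.+1%:R).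
have node_ge0 n k : 0 <= node n k by rewrite mulr_ge0// divr_ge0// ltW.
pose A n w := \sum_(0 <= k < n.+1) expR (lambda * node n k) *
  (complex.Re (J (node n k.+1) w) - complex.Re (J (node n k) w)) - complex.Re (I t w).
pose B n w := \sum_(0 <= k < n.+1) expR (lambda * node n k) *
  (complex.Im (J (node n k.+1) w) - complex.Im (J (node n k) w)) - complex.Im (I t w).
pose Z n w := Num.sqrt (A n w ^+ 2 + B n w ^+ 2).
pose a w := expR (lambda * t) * complex.Re (V t w) - complex.Re v0 - complex.Re (I t w).
pose b w := expR (lambda * t) * complex.Im (V t w) - complex.Im v0 - complex.Im (I t w).
pose Y w := Num.sqrt (a w ^+ 2 + b w ^+ 2).
have mZ n : measurable_fun setT (Z n).
  have sqrtM : measurable_fun setT (@Num.sqrt R).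
    exact: (continuous_measurable_fun (@sqrt_continuous R)).
  apply: (measurableT_comp sqrtM).
  apply: measurable_funD; apply: measurable_funX; apply: measurable_funB;
    [apply: measurable_sum => k; apply: measurable_funM => //; apply: measurable_funB| |
     apply: measurable_sum => k; apply: measurable_funM => //; apply: measurable_funB|];
    by [apply: measurable_Re_process => //; exact: ltW|
        apply: measurable_Im_process => //; exact: ltW].
have ZE n w : Z n w = modulus
    (riemann_sum (fun s => expR (lambda * s)) J 0 t (uniform_partition t n) w - I t w).
  rewrite /modulus riemann_sum_uniform.
  have subRe (x y : Cplx R) : complex.Re (x - y) = complex.Re x - complex.Re y.
    by case: x y => ? ? [].
  have subIm (x y : Cplx R) : complex.Im (x - y) = complex.Im x - complex.Im y.
    by case: x y => ? ? [].
  rewrite subRe subIm Re_sum_real_mul Im_sum_real_mul /Z.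
  by congr (Num.sqrt ((_ - _) ^+ 2 + (_ - _) ^+ 2)); apply: eq_bigr => k _;
    rewrite ?subRe ?subIm.
have ZY : {ae P, forall w, Z n w @[n --> \oo] --> Y w}.
  near=> w.
  have cV : cadlag (V^~ w) by near: w; exact: (ou_cadlag V_ou).
  have J0 : J 0 w = 0 by near: w; exact: (stable_start J_stable).
  have VE : forall s : R, 0 <= s ->
      V s w = v0 + J s w - lambda%:C * Cintegral (V^~ w) 0 s.
    by near: w; exact: (ou_eq V_ou).
  have VRe s : 0 <= s -> complex.Re (J s w) = complex.Re (V s w) - complex.Re v0 +
      lambda * \int[lebesgue_measure]_(u in `[0, s]) complex.Re (V u w).
    by move=> /VE ->; rewrite Re_affine /Cintegral/=; ring.
  have VIm s : 0 <= s -> complex.Im (J s w) = complex.Im (V s w) - complex.Im v0 +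
      lambda * \int[lebesgue_measure]_(u in `[0, s]) complex.Im (V u w).
    by move=> /VE ->; rewrite Im_affine /Cintegral/=; ring.
  have V0 : V 0 w = v0.
    rewrite VE// J0 /Cintegral set_itv1 !Rintegral_set1.
    by rewrite addr0 mulr0 subr0.
  apply: (@cvg_comp _ _ _ (fun n => A n w ^+ 2 + B n w ^+ 2) Num.sqrt _
    (nbhs (a w ^+ 2 + b w ^+ 2))); last exact: sqrt_continuous.
  have cvgA : A n w @[n --> \oo] --> a w.
    apply: cvgB; last exact: cvg_cst.
    rewrite -V0; exact: (cvg_riemann_grid l0 (cadlag_Re cV) VRe).
  have cvgB : B n w @[n --> \oo] --> b w.
    apply: cvgB; last exact: cvg_cst.
    rewrite -V0; exact: (cvg_riemann_grid l0 (cadlag_Im cV) VIm).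
  by rewrite !expr2; apply: cvgD; apply: cvgM.
have ZP eps : 0 < eps -> P [set w | eps < Z n w] @[n --> \oo] --> 0%E.
  move=> e0.
  have := I_lim t (uniform_partition t) (ltW t0)
    (fun n => itv_partition_uniform n t0) (cvg_mesh_uniform t0) eps e0.
  by under eq_fun do under eq_set do rewrite -ZE.
have := ae_le0_of_cvg_in_probability mZ ZY ZP.
apply: filterS => w Yw.
have : a w ^+ 2 + b w ^+ 2 <= 0 by rewrite -sqrtr_eq0 eq_le Yw sqrtr_ge0.
rewrite le_eqVlt ltNge addr_ge0 ?sqr_ge0// orbF paddr_eq0 ?sqr_ge0//.
rewrite !sqrf_eq0 /a /b => /andP[/eqP aw /eqP bw].
apply/subr0_eq/eqP; rewrite -oppr_eq0 opprB eq_complex Re_affine Im_affine /=.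
by apply/andP; split; apply/eqP; lra.
Unshelve. all: end_near. Qed.

End ornstein_uhlenbeck_integral.

(** * Hitting times under a change of time *)

Section hitting_times.
Context {R : realType}.

Lemma abs_hitting_time_ge0 (theta : R -> R) (c : R) :
  (0 <= abs_hitting_time theta c)%E.
Proof.
by apply: le_ereal_inf_tmp => _ [t [t0 _] <-]; rewrite lee_fin.
Qed.

(** The increasing extension to [[0, +oo]] of an increasing bijection of the
    half-line: [+oo] stands for a level that is never attained. *)
Definition extend_by_pinfty (g : R -> R) (x : \bar R) : \bar R :=
  if x is r%:E then (g r)%:E else +oo%E.

(** The infimum need not be attained, hence the use of lower bounds: [h] and
    [g] are mutually inverse and increasing, so they exchange the lower bounds
    of the two sets of hitting times. *)
Lemma abs_hitting_time_time_change (theta theta' h g : R -> R) (c : R) :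
  time_change h g -> (forall t, 0 <= t -> theta t = theta' (h t)) ->
  abs_hitting_time theta c = extend_by_pinfty g (abs_hitting_time theta' c).
Proof.
move=> hg thetaE; have [_ hK gK h_le _ _] := hg.
have g_le := time_change_le (time_change_sym hg).
have hit_g s : 0 <= s -> `|theta' s| = c -> (abs_hitting_time theta c <= (g s)%:E)%E.
  move=> s0 sc; have [gs0 hgs] := gK _ s0; apply: ereal_inf_lbound => /=.
  by exists (g s) => //; split => //; rewrite thetaE// hgs.
have hit_h t : 0 <= t -> `|theta t| = c -> (abs_hitting_time theta' c <= (h t)%:E)%E.
  move=> t0 tc; have [ht0 _] := hK _ t0; apply: ereal_inf_lbound => /=.
  by exists (h t) => //; split => //; rewrite -thetaE.
have th0 := abs_hitting_time_ge0 theta c.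
have th'0 := abs_hitting_time_ge0 theta' c.
apply/eqP; rewrite eq_le; apply/andP; split.
- case E' : (abs_hitting_time theta' c) th'0 => [b||]//= b0; last exact: leey.
  move: b0; rewrite lee_fin => b0; have [gb0 hgb] := gK _ b0.
  (* A hitting time of [theta'] yields one of [theta], so finiteness is inherited. *)
  have [a Ea] : exists a, abs_hitting_time theta c = a%:E.
    have : (abs_hitting_time theta c < +oo)%E.
      have : (abs_hitting_time theta' c < +oo)%E by rewrite E' ltry.
      move=> /ereal_inf_lt[_ [s [s0 sc] <-] _].
      exact: le_lt_trans (hit_g _ s0 sc) (ltry _).
    by move: th0; case: (abs_hitting_time _ _) => // a; exists a.
  move: th0; rewrite Ea !lee_fin => a0; have [ha0 gha] := hK _ a0.
  rewrite -(h_le a (g b))// hgb -lee_fin -E'.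
  apply: le_ereal_inf_tmp => _ [s [s0 sc] <-].
  have := hit_g _ s0 sc; rewrite Ea !lee_fin; have [gs0 hgs] := gK _ s0.
  by rewrite -(h_le a (g s))// hgs.
- apply: le_ereal_inf_tmp => _ [t [t0 tc] <-].
  have [ht0 ght] := hK _ t0; have := hit_h _ t0 tc.
  move: th'0; case: (abs_hitting_time theta' c) => [b||]//=.
  by rewrite !lee_fin => b0; rewrite -(g_le b (h t))// ght.
Qed.

End hitting_times.

(** * Integrals of almost everywhere equal functions *)

Section ae_equal_integrals.
Import HBNNSimple.
Context {d : measure_display} {T : measurableType d} {R : realType}.
Variable mu : {measure set T -> \bar R}.

(** Stated for functions that may fail to be measurable, such as functions of a
    hitting time: a simple function below [f] lies below
    [g] once it is set to [0] on a null set, and this does not change its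
    integral. *)
Lemma ae_eq_ge0_integral (f g : T -> \bar R) :
  (forall w, 0 <= f w)%E -> (forall w, 0 <= g w)%E ->
  {ae mu, forall w, f w = g w} -> (\int[mu]_w f w = \int[mu]_w g w)%E.
Proof.
have le f' g' : (forall w, 0 <= f' w)%E -> (forall w, 0 <= g' w)%E ->
    {ae mu, forall w, f' w = g' w} -> (\int[mu]_w f' w <= \int[mu]_w g' w)%E.
  move=> f0 g0 [N [mN N0 fgN]]; rewrite !ge0_integralTE//=.
  apply: ge_ereal_sup => _ [s /= sf <-]; apply: ereal_sup_ubound.
  exists (proj_nnsfun s (measurableC mN)) => /=.
    move=> w; rewrite mindicE; have [wN|wN] := pselect (N w).
      by rewrite memNset ?mulr0//; apply.
    rewrite mem_set// mulr1.
    have <- : f' w = g' w by apply: contrapT => fg; exact/wN/fgN.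
    exact: sf.
  have E (s' : {nnsfun T >-> R}) : sintegral mu s' = (\int[mu]_w (s' w)%:E)%E.
    by rewrite integral_nnsfun// patch_setT.
  rewrite !E; apply: ae_eq_integral => //; try exact/measurable_EFinP.
  exists N; split => // w /= H; apply: contrapT => wN; apply: H => _.
  by rewrite mindicE mem_set// mulr1.
move=> f0 g0 fg; apply/eqP; rewrite eq_le !le//.
by apply: filterS fg => w ->.
Qed.

End ae_equal_integrals.

(** * The exponential clock *)

Section exponential_clock.
Context {R : realType}.
Implicit Types a : R.

Definition exp_clock a (s : R) : R := (expR (a * s) - 1) / a.
Definition log_clock a (s : R) : R := a^-1 * ln (1 + a * s).

Lemma exp_clock_time_change a : 0 < a -> time_change (exp_clock a) (log_clock a).
Proof.
move=> a0; have a_neq0 : a != 0 by rewrite gt_eqF.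
have expE s : 1 + a * exp_clock a s = expR (a * s).
  by rewrite /exp_clock mulrCA divff// mulr1 addrC subrK.
have pos s : 0 <= s -> 0 < 1 + a * s by move=> s0; rewrite ltr_pwDl// mulr_ge0// ltW.
split.
- by rewrite /exp_clock mulr0 expR0 subrr mul0r.
- move=> s s0; split; last by rewrite /log_clock expE expRK mulKf.
  by rewrite /exp_clock divr_ge0 ?(ltW a0)// subr_ge0 -expR0 ler_expR mulr_ge0// ltW.
- move=> s s0; split.
    by rewrite /log_clock mulr_ge0 ?invr_ge0 ?(ltW a0)// ln_ge0// lerDl mulr_ge0// ltW.
  rewrite /exp_clock /log_clock mulVKf// lnK; last by rewrite posrE pos.
  by rewrite addrC addKr mulrC mulKf.
- move=> s s' s0 s'0; rewrite /exp_clock ler_pM2r ?invr_gt0// lerD2r ler_expR.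
  by rewrite ler_pM2l.
- move=> s s0; apply: cvgM; last exact: cvg_cst.
  apply: cvgB; last exact: cvg_cst.
  apply: (@cvg_comp _ _ _ (fun s => a * s) expR _ (nbhs (a * s))).
    exact: mulrl_continuous.
  exact: continuous_expR.
- move=> s s0; apply: cvgM; first exact: cvg_cst.
  apply: (@cvg_comp _ _ _ (fun s => 1 + a * s) (@ln R) _ (nbhs (1 + a * s))).
    apply: cvgD; first exact: cvg_cst.
    exact: mulrl_continuous.
  exact/continuous_ln/pos.
Qed.

Lemma extend_log_clock a (x : \bar R) : 0 < a -> (0 <= x)%E ->
  extend_by_pinfty (log_clock a) x = (a^-1%:E * lne (1 + a%:E * x))%E.
Proof.
move=> a0; case: x => [s||]// s0; rewrite /extend_by_pinfty.
  rewrite -EFinM -EFinD lne_EFin ?EFinM//.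
  by rewrite ltr_pwDl// mulr_ge0// ltW.
by rewrite gt0_muley ?lte_fin// addey// /= gt0_muley// lte_fin invr_gt0.
Qed.

Lemma expeR_log_clock a u (x : \bar R) : 0 < a -> 0 < u -> (0 <= x)%E ->
  expeR (- (u%:E * extend_by_pinfty (log_clock a) x))%E =
  ((poweR (1 + a%:E * x) (u / a))^-1)%E.
Proof.
move=> a0 u0; case: x => [s||]// s0; rewrite /extend_by_pinfty; last first.
  rewrite !gt0_muley ?lte_fin// addey// poweRyr ?invey//.
  by rewrite gt_eqF// divr_gt0.
have p0 : 0 < 1 + a * s by rewrite ltr_pwDl// mulr_ge0// ltW.
rewrite -EFinM -EFinD poweR_EFin inver gt_eqF ?powR_gt0//= /powR gt_eqF//.
by rewrite -expRN /log_clock; congr (expR _)%:E; ring.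
Qed.

End exponential_clock.

(** * The Ornstein-Uhlenbeck process as a time-changed stable process *)

Theorem proposition6p2 (R : realType) (d : measure_display)
    (T : measurableType d) (P : probability T R)
    (alpha lambda : R) (v0 : Cplx R)
    (J V I Jt : R -> T -> Cplx R)
    (alpha_gt0 : 0 < alpha) (alpha_le2 : alpha <= 2)
    (lambda_gt0 : 0 < lambda) (v0_neq0 : v0 != 0)
    (J_stable : isotropic_stable P alpha 0 J)
    (V_ou : ornstein_uhlenbeck P lambda v0 J V)
    (I_integral : is_stochastic_integral P (fun s => expR (lambda * s)) J I)
    (Jt_stable : isotropic_stable P alpha v0 Jt)
    (Jt_eq : forall t : R, 0 <= t ->
       {ae P, forall w, v0 + I t w = Jt (alpha_hat alpha lambda t) w}) :
  (forall t : R, 0 <= t ->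
     alpha_hat alpha lambda t
       = (expR (alpha * lambda * t) - 1) / (alpha * lambda) /\
     alpha_hat_inv alpha lambda (alpha_hat alpha lambda t) = t /\
     alpha_hat alpha lambda (alpha_hat_inv alpha lambda t) = t) /\
  {ae P, forall w, forall t : R, 0 <= t ->
     winding (V^~ w) t = winding (Jt^~ w) (alpha_hat alpha lambda t)} /\
  (forall c : R, 0 < c ->
     {ae P, forall w,
        abs_hitting_time (winding (V^~ w)) c =
        (((alpha * lambda)^-1)%:E *
          lne (1 + (alpha * lambda)%:E *
                 abs_hitting_time (winding (Jt^~ w)) c))%E} /\
     forall u : R, 0 < u ->
       (\int[P]_w expeR (- (u%:E * abs_hitting_time (winding (V^~ w)) c)) =
        \int[P]_w (poweR (1 + (alpha * lambda)%:E *
                            abs_hitting_time (winding (Jt^~ w)) c)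
                     (u / (alpha * lambda)))^-1)%E).
Proof.
set a := alpha * lambda.
have a_gt0 : 0 < a by rewrite mulr_gt0.
have clock := exp_clock_time_change a_gt0.
have hatE t : 0 <= t -> alpha_hat alpha lambda t = exp_clock a t.
  by move=> t0; rewrite alpha_hatE.
have k_cont t : 0 <= t -> {for t, continuous (fun s => expR (lambda * s))}.
  move=> _; apply: (@cvg_comp _ _ _ (fun s => lambda * s) expR _ (nbhs (lambda * t))).
    exact: mulrl_continuous.
  exact: continuous_expR.
have windingE : {ae P, forall w, forall t : R, 0 <= t ->
    winding (V^~ w) t = winding (Jt^~ w) (exp_clock a t)}.
  have : {ae P, forall w, forall q : rat, 0 < q ->
      Jt (exp_clock a (ratr q)) w = (expR (lambda * ratr q))%:C * V (ratr q) w}.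
    apply: ae_forall_rat => q; have [q0|] := ltP 0 q; last by move=> _; exact: aeW.
    have q0R : (0 : R) < ratr q by rewrite ltr0q.
    have := Jt_eq _ (ltW q0R).
    have := ou_exp_integral lambda_gt0 q0R J_stable V_ou I_integral.
    by apply: filterS2 => w -> -> _; rewrite hatE// ltW.
  have := ou_cadlag V_ou; have := stable_cadlag Jt_stable.
  apply: filterS3 => w cJt cV Jtq t t0.
  apply: (winding_time_change clock t0 k_cont) => //.
    by move=> s _; rewrite expR_gt0.
  exact: time_changed_path_eq clock cV cJt k_cont Jtq.
have hittingE c : {ae P, forall w, abs_hitting_time (winding (V^~ w)) c =
    extend_by_pinfty (log_clock a) (abs_hitting_time (winding (Jt^~ w)) c)}.
  move: windingE; apply: filterS => w wE.
  exact: abs_hitting_time_time_change clock wE.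
split; last split.
- move=> t t0; have [_ hK gK _ _ _] := clock; split; first exact: alpha_hatE.
  split; first by rewrite hatE//; exact: (hK _ t0).2.
  by have [g0 hg] := gK _ t0; rewrite hatE.
- by move: windingE; apply: filterS => w wE t t0; rewrite hatE// wE.
- move=> c c0; split.
    have := hittingE c; apply: filterS => w ->.
    by rewrite extend_log_clock// abs_hitting_time_ge0.
  move=> u u0; apply: ae_eq_ge0_integral => [w|w|]; first exact: expeR_ge0.
    by rewrite inve_ge0 poweR_ge0.
  have := hittingE c; apply: filterS => w ->.
  by rewrite expeR_log_clock// abs_hitting_time_ge0.
Qed.
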